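(* Let $R$ be a ring and let $(P,Q,\psi)$ be an $R$-system which satisfies condition (FS), and assume that there exists a uniquely maximal faithful $\psi$-compatible two-sided ideal of $R$. If $A$ is a $\mathbb{Z}$-graded ring and $\eta:\mathcal{O}_{(P,Q,\psi)}\to A$ is a graded ring homomorphism with $\eta(p_r)\neq0$ for every $r\in R\setminus\{0\}$, then $\eta$ is injective.
   Context: Rings are associative, not necessarily unital. For $R$-bimodules $P,Q$, $P\otimes Q$ is the $R$-balanced tensor product. ''Linear'' means additive. An $R$-system is a triple $(P,Q,\psi)$ where $P,Q$ are $R$-bimodules and $\psi:P\otimes Q\to R$ is an $R$-bimodule homomorphism. A covariant representation of $(P,Q,\psi)$ is a quadruple $(S,T,\sigma,B)$ where $B$ is a ring, $S:P\to B$ and $T:Q\to B$ are linear maps, $\sigma:R\to B$ is a ring homomorphism, and $S(pr)=S(p)\sigma(r)$, $S(rp)=\sigma(r)S(p)$, $T(qr)=T(q)\sigma(r)$, $T(rq)=\sigma(r)T(q)$, $\sigma(\psi(p\otimes q))=S(p)T(q)$ for all $r\in R,p\in P,q\in Q$. It is surjective if $B$ is generated as a ring by $\sigma(R)\cup T(Q)\cup S(P)$, injective if $\sigma$ is injective. The Toeplitz representation $(\iota_P,\iota_Q,\iota_R,\mathcal{T}_{(P,Q,\psi)})$ is the (up to isomorphism unique) surjective covariant representation such that for every covariant representation $(S,T,\sigma,B)$ there is a unique ring homomorphism $\eta:\mathcal{T}_{(P,Q,\psi)}\to B$ with $\eta\circ\iota_R=\sigma$, $\eta\circ\iota_Q=T$,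 $\eta\circ\iota_P=S$; it exists and is injective. For $p\in P,q\in Q$: $\theta_{q,p}:Q\to Q$, $x\mapsto q\psi(p\otimes x)$, and $\theta_{p,q}:P\to P$, $y\mapsto\psi(y\otimes q)p$. $\mathcal{F}_P(Q)$ is the additive span of all $\theta_{q,p}$, $\mathcal{F}_Q(P)$ the additive span of all $\theta_{p,q}$. Condition (FS): for all finite sets $\{q_1,\dots,q_n\}\subseteq Q$, $\{p_1,\dots,p_m\}\subseteq P$ there exist $\Theta\in\mathcal{F}_P(Q)$ and $\Omega\in\mathcal{F}_Q(P)$ with $\Theta(q_i)=q_i$ and $\Omega(p_j)=p_j$ for all $i,j$. $\Delta:R\to\operatorname{End}(Q_R)$ is the ring homomorphism $\Delta(r)(q)=rq$. Under (FS) there is a unique ring homomorphism $\pi:\mathcal{F}_P(Q)\to\mathcal{T}_{(P,Q,\psi)}$ with $\pi(\theta_{q,p})=\iota_Q(q)\iota_P(p)$. A two-sided ideal $J$ of $R$ is $\psi$-compatible if $J\subseteq\Delta^{-1}(\mathcal{F}_P(Q))$; a $\psi$-compatible $J$ is faithful if $J\cap\ker\Delta=\{0\}$; a faithful $\psi$-compatible two-sided ideal $J$ is uniquely maximal if $J'\subseteq J$ for every faithful $\psi$-compatible two-sided ideal $J'$ of $R$. For $\psi$-compatible $J$, $\mathcal{T}(J)$ is the two-sided ideal of $\mathcal{T}_{(P,Q,\psi)}$ generated by $\{\iota_R(x)-\pi(\Delta(x)):x\in J\}$, $\mathcal{O}_{(P,Q,\psi)}(J):=\mathcal{T}_{(P,Q,\psi)}/\mathcal{T}(J)$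 with quotient map $\rho_J$, and $\iota_R^J=\rho_J\circ\iota_R$, $\iota_Q^J=\rho_J\circ\iota_Q$, $\iota_P^J=\rho_J\circ\iota_P$. The ring $\mathcal{O}_{(P,Q,\psi)}(J)$ carries the unique $\mathbb{Z}$-grading for which $\iota_R^J(R)$, $\iota_Q^J(Q)$, $\iota_P^J(P)$ lie in degrees $0,1,-1$ respectively. If $J$ is the uniquely maximal faithful $\psi$-compatible two-sided ideal of $R$, the Cuntz-Pimsner ring is $\mathcal{O}_{(P,Q,\psi)}:=\mathcal{O}_{(P,Q,\psi)}(J)$ with this grading, and $p_r:=\iota_R^J(r)$ for $r\in R$. *)

(* Defs.v *)
From HB Require Import structures.
From mathcomp Require Import all_boot all_order all_algebra generic_quotient.
From mathcomp Require Import boolp classical_sets.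

Set Implicit Arguments.
Unset Strict Implicit.
Unset Printing Implicit Defensive.

Import GRing.Theory.
Local Open Scope ring_scope.
Local Open Scope classical_set_scope.

(* MathComp's ring structures all have a unit, so associative rings that are
   not necessarily unital are introduced here. *)
HB.mixin Record Zmodule_isRng R of GRing.Zmodule R := {
  rmul : R -> R -> R;
  rmulA : associative rmul;
  rmulDl : left_distributive rmul +%R;
  rmulDr : right_distributive rmul +%R
}.

#[short(type="rngType")]
HB.structure Definition Rng := {R of Zmodule_isRng R & GRing.Zmodule R}.

Notation "x ** y" := (rmul x y) (at level 40, left associativity) : ring_scope.

HB.mixin Record Zmodule_isBimodule (R : rngType) V of GRing.Zmodule V := {
  lact : R -> V -> V;
  ract : V -> R -> V;
  lactDl : forall v, {morph lact^~ v : r s / r + s};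
  lactDr : forall r, {morph lact r : v w / v + w};
  lactA : forall r s v, lact (r ** s) v = lact r (lact s v);
  ractDl : forall r, {morph ract^~ r : v w / v + w};
  ractDr : forall v, {morph ract v : r s / r + s};
  ractA : forall v r s, ract v (r ** s) = ract (ract v r) s;
  lractA : forall r v s, ract (lact r v) s = lact r (ract v s)
}.

#[short(type="bimodType")]
HB.structure Definition Bimodule (R : rngType) :=
  {V of Zmodule_isBimodule R V & GRing.Zmodule V}.

Notation "r *> v" := (lact r v) (at level 40, left associativity) : ring_scope.
Notation "v <* r" := (ract v r) (at level 40, left associativity) : ring_scope.

Section ZmoduleFacts.
Variables (U V : zmodType) (f : U -> V).
Hypothesis fD : {morph f : x y / x + y}.

Lemma morphD0 : f 0 = 0.
Proof. by apply: (addrI (f 0)); rewrite -fD !addr0. Qed.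

Lemma morphDN : {morph f : x / - x}.
Proof. by move=> x; apply: (addrI (f x)); rewrite -fD !subrr morphD0. Qed.

Lemma morphDB : {morph f : x y / x - y}.
Proof. by move=> x y; rewrite fD morphDN. Qed.

End ZmoduleFacts.

Section Subobjects.
Variable B : rngType.

Definition subgroup (V : zmodType) (S : set V) :=
  S 0 /\ forall x y, S x -> S y -> S (x - y).

Definition subrng (S : set B) :=
  subgroup S /\ forall x y, S x -> S y -> S (x ** y).

Definition two_sided_ideal (I : set B) :=
  subgroup I /\ forall x y, I x -> I (y ** x) /\ I (x ** y).

Record ideal := Ideal {
  ideal_set :> set B;
  idealP : two_sided_ideal ideal_set
}.

Lemma ideal_gen_subproof (G : set B) :
  two_sided_ideal (smallest two_sided_ideal G).
Proof.
split=> [|x y Ix]; first split=> [M [[[M0 _] _] _] //|x y Ix Iy M MG].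
  by case: (MG) => -[[_ MB] _] _; apply: MB; [apply: Ix | apply: Iy].
by split=> M MG; case: (MG) => -[_ MM] _; case: (MM x y (Ix M MG)).
Qed.

Definition ideal_gen (G : set B) : ideal := Ideal (ideal_gen_subproof G).

End Subobjects.

Definition rng_hom (A B : rngType) (f : A -> B) :=
  {morph f : x y / x + y} /\ {morph f : x y / x ** y}.

Section Quotient.
Variables (B : rngType) (I : ideal B).

Definition cong_mod (x y : B) := `[< ideal_set I (x - y) >].

Lemma ideal0 : ideal_set I 0. Proof. by case: (idealP I) => -[]. Qed.

Lemma idealB x y : ideal_set I x -> ideal_set I y -> ideal_set I (x - y).
Proof. by case: (idealP I) => -[_ H] _; apply: H. Qed.

Lemma idealN x : ideal_set I x -> ideal_set I (- x).
Proof. by move=> Ix; rewrite -[- x]add0r; apply: idealB => //; apply: ideal0. Qed.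

Lemma idealD x y : ideal_set I x -> ideal_set I y -> ideal_set I (x + y).
Proof. by move=> Ix Iy; rewrite -[y]opprK; apply: idealB => //; apply: idealN. Qed.

Lemma idealMl x y : ideal_set I x -> ideal_set I (y ** x).
Proof. by move=> Ix; case: (idealP I) => _ /(_ x y Ix) []. Qed.

Lemma idealMr x y : ideal_set I x -> ideal_set I (x ** y).
Proof. by move=> Ix; case: (idealP I) => _ /(_ x y Ix) []. Qed.

Lemma cong_mod_equiv : equiv_class_of cong_mod.
Proof.
split=> [x|x y|y x z].
- by apply/asboolP; rewrite subrr; apply: ideal0.
- by apply/asboolP/asboolP => /idealN; rewrite opprB.
- by move=> /asboolP Ixy /asboolP Iyz; apply/asboolP; have := idealD Ixy Iyz;
    rewrite addrA subrK.
Qed.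

Canonical cong_mod_equiv_rel := EquivRelPack cong_mod_equiv.

Definition quot_rng := {eq_quot cong_mod}%qT.

HB.instance Definition _ := Choice.on quot_rng.
HB.instance Definition _ := EqQuotient.on quot_rng.

Definition quot_map (x : B) : quot_rng := (\pi_quot_rng x)%qT.

Lemma quot_mapP x y : quot_map x = quot_map y <-> ideal_set I (x - y).
Proof. by split=> [/eqmodP /asboolP|H]; last by apply/eqmodP/asboolP. Qed.

Lemma quot_map_surj (z : quot_rng) : exists x, quot_map x = z.
Proof. by exists (repr z); rewrite /quot_map reprK. Qed.

Lemma repr_quot x : ideal_set I (x - repr (quot_map x)).
Proof. by apply/quot_mapP; rewrite /quot_map reprK. Qed.

Definition quot_add (u v : quot_rng) := quot_map (repr u + repr v).
Definition quot_opp (u : quot_rng) := quot_map (- repr u).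
Definition quot_mul (u v : quot_rng) := quot_map (repr u ** repr v).

Lemma quot_addE x y : quot_add (quot_map x) (quot_map y) = quot_map (x + y).
Proof.
apply/esym/quot_mapP; rewrite opprD addrACA.
by apply: idealD; apply: repr_quot.
Qed.

Lemma quot_oppE x : quot_opp (quot_map x) = quot_map (- x).
Proof. by apply/esym/quot_mapP; rewrite -opprD; apply/idealN/repr_quot. Qed.

Lemma quot_mulE x y : quot_mul (quot_map x) (quot_map y) = quot_map (x ** y).
Proof.
apply/esym/quot_mapP; set x' := repr _; set y' := repr _.
have -> : x ** y - x' ** y' = (x - x') ** y + x' ** (y - y').
  rewrite (morphDB (rmulDr x')).
  by rewrite (@morphDB _ _ (rmul^~ y)) ?addrA ?subrK // => a b; rewrite rmulDl.
by apply: idealD; [apply: idealMr | apply: idealMl]; apply: repr_quot.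
Qed.

Lemma quot_addA : associative quot_add.
Proof.
move=> u v w; have [[x <-] [y <-]] := (quot_map_surj u, quot_map_surj v).
by have [z <-] := quot_map_surj w; rewrite !quot_addE addrA.
Qed.

Lemma quot_addC : commutative quot_add.
Proof.
move=> u v; have [[x <-] [y <-]] := (quot_map_surj u, quot_map_surj v).
by rewrite !quot_addE addrC.
Qed.

Lemma quot_add0 : left_id (quot_map 0) quot_add.
Proof. by move=> u; have [x <-] := quot_map_surj u; rewrite quot_addE add0r. Qed.

Lemma quot_addN : left_inverse (quot_map 0) quot_opp quot_add.
Proof.
by move=> u; have [x <-] := quot_map_surj u; rewrite quot_oppE quot_addE addNr.
Qed.

HB.instance Definition _ :=
  GRing.isZmodule.Build quot_rng quot_addA quot_addC quot_add0 quot_addN.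

Lemma quot_mapD : {morph quot_map : x y / x + y}.
Proof. by move=> x y; rewrite -quot_addE. Qed.

Lemma quot_mulA : associative quot_mul.
Proof.
move=> u v w; have [[x <-] [y <-]] := (quot_map_surj u, quot_map_surj v).
by have [z <-] := quot_map_surj w; rewrite !quot_mulE rmulA.
Qed.

Lemma quot_mulDl : left_distributive quot_mul +%R.
Proof.
move=> u v w; have [[x <-] [y <-]] := (quot_map_surj u, quot_map_surj v).
by have [z <-] := quot_map_surj w; rewrite -quot_mapD !quot_mulE -quot_mapD rmulDl.
Qed.

Lemma quot_mulDr : right_distributive quot_mul +%R.
Proof.
move=> u v w; have [[x <-] [y <-]] := (quot_map_surj u, quot_map_surj v).
by have [z <-] := quot_map_surj w; rewrite -quot_mapD !quot_mulE -quot_mapD rmulDr.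
Qed.

HB.instance Definition _ :=
  Zmodule_isRng.Build quot_rng quot_mulA quot_mulDl quot_mulDr.

Lemma quot_map_hom : rng_hom quot_map.
Proof. by split=> x y; [exact: quot_mapD | rewrite -quot_mulE]. Qed.

End Quotient.

Section Tensor.
Variables (R : rngType) (P Q : bimodType R).

(* The list [:: (p1, q1); ...; (pn, qn)] stands for the formal sum
   p1 (x) q1 + ... + pn (x) qn.  The relation below is the smallest congruence
   (for concatenation) that makes sums commutative and (x) biadditive and
   R-balanced.  No formal opposites are needed, as -(p (x) q) = (-p) (x) q. *)
Inductive tensor_eq : seq (P * Q) -> seq (P * Q) -> Prop :=
| teq_refl s : tensor_eq s s
| teq_sym s t : tensor_eq s t -> tensor_eq t s
| teq_trans s t u : tensor_eq s t -> tensor_eq t u -> tensor_eq s u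
| teq_cat s s' t t' :
    tensor_eq s s' -> tensor_eq t t' -> tensor_eq (s ++ t) (s' ++ t')
| teq_comm s t : tensor_eq (s ++ t) (t ++ s)
| teq_0l q : tensor_eq [:: (0, q)] [::]
| teq_Dl p p' q : tensor_eq [:: (p + p', q)] [:: (p, q); (p', q)]
| teq_Dr p q q' : tensor_eq [:: (p, q + q')] [:: (p, q); (p, q')]
| teq_bal p r q : tensor_eq [:: (p <* r, q)] [:: (p, r *> q)].

Definition tensor_rel s t := `[< tensor_eq s t >].

Lemma tensor_rel_equiv : equiv_class_of tensor_rel.
Proof.
split=> [s|s t|t s u].
- exact/asboolP/teq_refl.
- by apply/asboolP/asboolP; apply: teq_sym.
- by move=> /asboolP st /asboolP tu; apply/asboolP; apply: teq_trans st tu.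
Qed.

Canonical tensor_equiv_rel := EquivRelPack tensor_rel_equiv.

Definition tensor := {eq_quot tensor_rel}%qT.

HB.instance Definition _ := Choice.on tensor.
HB.instance Definition _ := EqQuotient.on tensor.

Definition tensor_class (s : seq (P * Q)) : tensor := (\pi_tensor s)%qT.
Definition pure_tensor (p : P) (q : Q) : tensor := tensor_class [:: (p, q)].

Lemma tensor_classP s t : tensor_class s = tensor_class t <-> tensor_eq s t.
Proof. by split=> [/eqmodP /asboolP|H]; last by apply/eqmodP/asboolP. Qed.

Lemma tensor_class_surj (z : tensor) : exists s, tensor_class s = z.
Proof. by exists (repr z); rewrite /tensor_class reprK. Qed.

Lemma repr_tensor s : tensor_eq s (repr (tensor_class s)).
Proof. by apply/tensor_classP; rewrite /tensor_class reprK. Qed.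

Definition seq_opp (s : seq (P * Q)) := [seq (- x.1, x.2) | x <- s].
Definition seq_lact (r : R) (s : seq (P * Q)) := [seq (r *> x.1, x.2) | x <- s].
Definition seq_ract (s : seq (P * Q)) (r : R) := [seq (x.1, x.2 <* r) | x <- s].

Lemma teq_map (f : P -> P) (g : Q -> Q) :
    {morph f : p p' / p + p'} -> {morph g : q q' / q + q'} ->
    (forall p r q, tensor_eq [:: (f (p <* r), g q)] [:: (f p, g (r *> q))]) ->
  forall s t, tensor_eq s t ->
    tensor_eq [seq (f x.1, g x.2) | x <- s] [seq (f x.1, g x.2) | x <- t].
Proof.
move=> fD gD fg s t; elim=> {s t} /=.
- by move=> s; apply: teq_refl.
- by move=> s t _; apply: teq_sym.
- by move=> s t u _ st _ tu; apply: teq_trans st tu.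
- by move=> s s' t t' _ ss _ tt; rewrite !map_cat; apply: teq_cat.
- by move=> s t; rewrite !map_cat; apply: teq_comm.
- by move=> q; rewrite (morphD0 fD); apply: teq_0l.
- by move=> p p' q; rewrite fD; apply: teq_Dl.
- by move=> p q q'; rewrite gD; apply: teq_Dr.
- exact: fg.
Qed.

Lemma teq_opp s t : tensor_eq s t -> tensor_eq (seq_opp s) (seq_opp t).
Proof.
apply: (@teq_map -%R id) => // [p p'|p r q]; first exact: opprD.
have -> : - (p <* r) = (- p) <* r by rewrite (morphDN (ractDl (s := P) r)).
exact: teq_bal.
Qed.

Lemma teq_lact r s t : tensor_eq s t -> tensor_eq (seq_lact r s) (seq_lact r t).
Proof.
apply: (@teq_map (lact r) id) => // [|p r' q]; first exact: lactDr.
by rewrite -lractA; apply: teq_bal.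
Qed.

Lemma teq_ract r s t : tensor_eq s t -> tensor_eq (seq_ract s r) (seq_ract t r).
Proof.
apply: (@teq_map id (ract^~ r)) => // [|p r' q]; first exact: ractDl.
by rewrite lractA; apply: teq_bal.
Qed.

Definition tensor_add (u v : tensor) := tensor_class (repr u ++ repr v).
Definition tensor_opp (u : tensor) := tensor_class (seq_opp (repr u)).
Definition tensor_lact (r : R) (u : tensor) := tensor_class (seq_lact r (repr u)).
Definition tensor_ract (u : tensor) (r : R) := tensor_class (seq_ract (repr u) r).

Lemma tensor_addE s t :
  tensor_add (tensor_class s) (tensor_class t) = tensor_class (s ++ t).
Proof. by apply/esym/tensor_classP/teq_cat; apply: repr_tensor. Qed.

Lemma tensor_oppE s : tensor_opp (tensor_class s) = tensor_class (seq_opp s).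
Proof. by apply/esym/tensor_classP/teq_opp/repr_tensor. Qed.

Lemma tensor_lactE r s :
  tensor_lact r (tensor_class s) = tensor_class (seq_lact r s).
Proof. by apply/esym/tensor_classP/teq_lact/repr_tensor. Qed.

Lemma tensor_ractE s r :
  tensor_ract (tensor_class s) r = tensor_class (seq_ract s r).
Proof. by apply/esym/tensor_classP/teq_ract/repr_tensor. Qed.

Lemma tensor_addA : associative tensor_add.
Proof.
move=> u v w; have [[x <-] [y <-]] := (tensor_class_surj u, tensor_class_surj v).
by have [z <-] := tensor_class_surj w; rewrite !tensor_addE catA.
Qed.

Lemma tensor_addC : commutative tensor_add.
Proof.
move=> u v; have [[x <-] [y <-]] := (tensor_class_surj u, tensor_class_surj v).
by rewrite !tensor_addE; apply/tensor_classP/teq_comm.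
Qed.

Lemma tensor_add0 : left_id (tensor_class [::]) tensor_add.
Proof. by move=> u; have [x <-] := tensor_class_surj u; rewrite tensor_addE. Qed.

Lemma tensor_addN : left_inverse (tensor_class [::]) tensor_opp tensor_add.
Proof.
move=> u; have [s <-] := tensor_class_surj u.
rewrite tensor_oppE tensor_addE; apply/tensor_classP.
elim: s => [|[p q] s IHs] /=; first exact: teq_refl.
apply: (@teq_trans _ ([:: (- p, q); (p, q)] ++ (seq_opp s ++ s))).
  rewrite -cat1s -[(p, q) :: s]cat1s /= -[(- p, q) :: _ :: _]cat1s.
  apply: (@teq_cat [:: _] [:: _]); first exact: teq_refl.
  rewrite -[(p, q) :: seq_opp s ++ s]/([:: (p, q)] ++ seq_opp s ++ s) !catA.
  rewrite -[seq_opp s ++ (p, q) :: s]/(seq_opp s ++ [:: (p, q)] ++ s) catA.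
  by apply: teq_cat; [apply: teq_comm | apply: teq_refl].
rewrite -[[::]]/([::] ++ [::]); apply: teq_cat => //.
apply: teq_trans (teq_sym (teq_Dl _ _ _)) _; rewrite addNr.
exact: teq_0l.
Qed.

HB.instance Definition _ :=
  GRing.isZmodule.Build tensor tensor_addA tensor_addC tensor_add0 tensor_addN.

Lemma tensor_classD s t :
  tensor_class (s ++ t) = tensor_class s + tensor_class t.
Proof. by rewrite -tensor_addE. Qed.

Lemma tensor_class_sum s :
  tensor_class s = \sum_(x <- s) pure_tensor x.1 x.2.
Proof.
elim: s => [|[p q] s IHs]; first by rewrite big_nil.
by rewrite big_cons -IHs -tensor_classD.
Qed.

Lemma pure_tensorDl q : {morph pure_tensor^~ q : p p' / p + p'}.
Proof. by move=> p p'; rewrite -tensor_classD; apply/tensor_classP/teq_Dl. Qed.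

Lemma pure_tensorDr p : {morph pure_tensor p : q q' / q + q'}.
Proof. by move=> q q'; rewrite -tensor_classD; apply/tensor_classP/teq_Dr. Qed.

Lemma pure_tensor_bal p r q : pure_tensor (p <* r) q = pure_tensor p (r *> q).
Proof. exact/tensor_classP/teq_bal. Qed.

Lemma tensor_lactDr r : {morph tensor_lact r : u v / u + v}.
Proof.
move=> u v; have [[x <-] [y <-]] := (tensor_class_surj u, tensor_class_surj v).
by rewrite -tensor_classD !tensor_lactE -tensor_classD -map_cat.
Qed.

Lemma tensor_ractDl r : {morph tensor_ract^~ r : u v / u + v}.
Proof.
move=> u v; have [[x <-] [y <-]] := (tensor_class_surj u, tensor_class_surj v).
by rewrite -tensor_classD !tensor_ractE -tensor_classD -map_cat.
Qed.

Lemma tensor_lactDl u : {morph tensor_lact^~ u : r s / r + s}.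
Proof.
move=> r s; have [x <-] := tensor_class_surj u; rewrite !tensor_lactE.
rewrite !tensor_class_sum !big_map -big_split /=.
by apply: eq_bigr => -[p q] _ /=; rewrite lactDl pure_tensorDl.
Qed.

Lemma tensor_ractDr u : {morph tensor_ract u : r s / r + s}.
Proof.
move=> r s; have [x <-] := tensor_class_surj u; rewrite !tensor_ractE.
rewrite !tensor_class_sum !big_map -big_split /=.
by apply: eq_bigr => -[p q] _ /=; rewrite ractDr pure_tensorDr.
Qed.

Lemma tensor_lactA r s u :
  tensor_lact (r ** s) u = tensor_lact r (tensor_lact s u).
Proof.
have [x <-] := tensor_class_surj u; rewrite !tensor_lactE /seq_lact -map_comp.
by congr tensor_class; apply: eq_map => -[p q] /=; rewrite lactA.
Qed.

Lemma tensor_ractA u r s :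
  tensor_ract u (r ** s) = tensor_ract (tensor_ract u r) s.
Proof.
have [x <-] := tensor_class_surj u; rewrite !tensor_ractE /seq_ract -map_comp.
by congr tensor_class; apply: eq_map => -[p q] /=; rewrite ractA.
Qed.

Lemma tensor_lractA r u s :
  tensor_ract (tensor_lact r u) s = tensor_lact r (tensor_ract u s).
Proof.
have [x <-] := tensor_class_surj u.
by rewrite tensor_lactE !tensor_ractE tensor_lactE /seq_lact /seq_ract -!map_comp.
Qed.

HB.instance Definition _ := Zmodule_isBimodule.Build R tensor
  tensor_lactDl tensor_lactDr tensor_lactA
  tensor_ractDl tensor_ractDr tensor_ractA tensor_lractA.

Lemma lact_pure r p q : r *> pure_tensor p q = pure_tensor (r *> p) q.
Proof. exact: tensor_lactE. Qed.

Lemma ract_pure p q r : pure_tensor p q <* r = pure_tensor p (q <* r).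
Proof. exact: tensor_ractE. Qed.

End Tensor.

Notation "p \ox q" := (pure_tensor p q) (at level 40, left associativity).

Section System.
Variables (R : rngType) (P Q : bimodType R).
Implicit Types (p : P) (q : Q) (r : R).

Record R_system (psi : tensor P Q -> R) : Prop := {
  psiD : {morph psi : t u / t + u};
  psi_lact : forall r t, psi (r *> t) = r ** psi t;
  psi_ract : forall t r, psi (t <* r) = psi t ** r
}.

Variable psi : tensor P Q -> R.

Record covariant_rep (B : rngType) (S : P -> B) (T : Q -> B) (sigma : R -> B)
    : Prop := {
  covS_add : {morph S : x y / x + y};
  covT_add : {morph T : x y / x + y};
  cov_sigma : rng_hom sigma;
  covS_ract : forall p r, S (p <* r) = S p ** sigma r;
  covS_lact : forall r p, S (r *> p) = sigma r ** S p;
  covT_ract : forall q r, T (q <* r) = T q ** sigma r;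
  covT_lact : forall r q, T (r *> q) = sigma r ** T q;
  cov_psi : forall p q, sigma (psi (p \ox q)) = S p ** T q
}.

Definition surjective_rep (B : rngType) (S : P -> B) (T : Q -> B)
    (sigma : R -> B) :=
  smallest (@subrng B) (range sigma `|` range T `|` range S) = setT.

Definition toeplitz_rep (TT : rngType) (iP : P -> TT) (iQ : Q -> TT)
    (iR : R -> TT) :=
  [/\ covariant_rep iP iQ iR,
      surjective_rep iP iQ iR &
      forall (B : rngType) (S : P -> B) (T : Q -> B) (sigma : R -> B),
        covariant_rep S T sigma ->
        exists! eta : TT -> B,
          [/\ rng_hom eta, eta \o iR = sigma, eta \o iQ = T & eta \o iP = S]].

Definition thetaQ q p : Q -> Q := fun x => q <* psi (p \ox x).
Definition thetaP p q : P -> P := fun y => psi (y \ox q) *> p.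

(* Additive spans of the theta's.  Finite sums suffice, since
   - thetaQ q p = thetaQ (- q) p and - thetaP p q = thetaP (- p) q. *)
Definition FPQ : set (Q -> Q) := [set f |
  exists s : seq (Q * P), forall x, f x = \sum_(c <- s) thetaQ c.1 c.2 x].
Definition FQP : set (P -> P) := [set f |
  exists s : seq (P * Q), forall y, f y = \sum_(c <- s) thetaP c.1 c.2 y].

Definition conditionFS := forall (qs : seq Q) (ps : seq P),
  exists Theta Omega, [/\ FPQ Theta, FQP Omega,
    {in qs, forall q, Theta q = q} & {in ps, forall p, Omega p = p}].

Definition Delta r : Q -> Q := fun q => r *> q.

(* pi is the ring homomorphism FPQ -> TT (addition is pointwise, multiplication
   is composition) with thetaQ q p |-> iQ q ** iP p.  Its values outside FPQ are
   irrelevant. *)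
Record is_piT (TT : rngType) (iP : P -> TT) (iQ : Q -> TT)
    (pi : (Q -> Q) -> TT) : Prop := {
  piT_add : forall f g, FPQ f -> FPQ g -> pi (f \+ g) = pi f + pi g;
  piT_mul : forall f g, FPQ f -> FPQ g -> pi (f \o g) = pi f ** pi g;
  piT_theta : forall q p, pi (thetaQ q p) = iQ q ** iP p
}.

Definition compatible (J : ideal R) := J `<=` Delta @^-1` FPQ.

Definition ker_Delta : set R := [set r | forall q, Delta r q = 0].

Definition faithful (J : ideal R) := J `&` ker_Delta = [set 0].

Definition uniquely_maximal (J : ideal R) :=
  [/\ compatible J, faithful J &
      forall J' : ideal R, compatible J' -> faithful J' -> J' `<=` J].

Section RelativeCuntzPimsner.
Variables (TT : rngType) (iR : R -> TT) (pi : (Q -> Q) -> TT) (J : ideal R).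

Definition TJ : ideal TT := ideal_gen [set iR x - pi (Delta x) | x in J].

Definition OJ : rngType := quot_rng TJ.

Definition rhoJ : TT -> OJ := @quot_map TT TJ.

End RelativeCuntzPimsner.

End System.

(* A = (+)_n Ag n with Ag m ** Ag n contained in Ag (m + n) *)
Record Z_grading (A : rngType) (Ag : int -> set A) : Prop := {
  grading_subgroup : forall n, subgroup (Ag n);
  grading_mul : forall m n a b, Ag m a -> Ag n b -> Ag (m + n) (a ** b);
  grading_span : forall a, exists (s : seq int) (c : int -> A),
    (forall n, Ag n (c n)) /\ a = \sum_(n <- s) c n;
  grading_direct : forall (s : seq int) (c : int -> A),
    uniq s -> (forall n, Ag n (c n)) -> \sum_(n <- s) c n = 0 ->
    {in s, forall n, c n = 0}
}.

Definition graded_hom (A B : rngType) (Ag : int -> set A) (Bg : int -> set B)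
    (f : A -> B) :=
  rng_hom f /\ forall n a, Ag n a -> Bg n (f a).

(* The grading of OJ that puts the images of R, Q, P in degrees 0, 1, -1 *)
Definition OJ_grading (R : rngType) (P Q : bimodType R) (TT : rngType)
    (iP : P -> TT) (iQ : Q -> TT) (iR : R -> TT) (pi : (Q -> Q) -> TT)
    (J : ideal R) (Og : int -> set (OJ iR pi J)) :=
  [/\ Z_grading Og,
      forall r, Og 0 (rhoJ iR pi J (iR r)),
      forall q, Og 1 (rhoJ iR pi J (iQ q)) &
      forall p, Og (- 1) (rhoJ iR pi J (iP p))].

(* Main.v *)
Require Import Defs.
From mathcomp Require Import all_boot all_order all_algebra.
From mathcomp Require Import boolp classical_sets.

Set Implicit Arguments.
Unset Strict Implicit.
Unset Printing Implicit Defensive.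
Local Open Scope ring_scope.

Import GRing.Theory.
Local Open Scope classical_set_scope.

(* The ring O is spanned by the homogeneous sets "words in TQ, then sigma(R),
   then words in SP", and since eta is graded its kernel is the sum of its
   homogeneous parts.  By (FS), an element x of positive degree is a sum of
   T(q) S(p) x, and one of negative degree a sum of x T(q) S(p); so S(p) x = 0
   for all p (resp. x T(q) = 0 for all q) forces x = 0, and this reduces the
   claim to degree 0.

   In degree 0, let x be in sigma(R) + TQ SP + ... + (TQ)^m (SP)^m with
   eta x = 0.  By induction on m, S(p) x T(q) = 0 for all p, q, hence
   x T(q) = 0, hence x = sigma(r) - pi(Delta r) with Delta r in F_P(Q).  The r
   with Delta r in F_P(Q) and eta(sigma r) = eta(pi(Delta r)) form a compatible
   ideal, which is faithful because eta is injective on sigma(R).  By maximality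
   r lies in J, so x = 0. *)

(** * Arithmetic in rings without unit *)

Section RngFacts.
Variable B : rngType.
Implicit Types x y z : B.

Lemma rmul0l x : 0 ** x = 0.
Proof. by apply: (@morphD0 _ _ (rmul^~ x)) => a b; rewrite rmulDl. Qed.

Lemma rmul0r x : x ** 0 = 0.
Proof. exact: morphD0 (rmulDr x). Qed.

Lemma rmulNl x y : (- x) ** y = - (x ** y).
Proof. by apply: (@morphDN _ _ (rmul^~ y)) => a b; rewrite rmulDl. Qed.

Lemma rmulNr x y : x ** (- y) = - (x ** y).
Proof. exact: morphDN (rmulDr x) y. Qed.

Lemma rmulBl x y z : (x - y) ** z = x ** z - y ** z.
Proof. by rewrite rmulDl rmulNl. Qed.

Lemma rmul_suml I (l : seq I) (F : I -> B) y :
  (\sum_(i <- l) F i) ** y = \sum_(i <- l) F i ** y.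
Proof.
by apply: (big_morph (rmul^~ y)) => [a b|]; [rewrite rmulDl | rewrite rmul0l].
Qed.

Lemma rmul_sumr I (l : seq I) (F : I -> B) y :
  y ** (\sum_(i <- l) F i) = \sum_(i <- l) y ** F i.
Proof. by apply: (big_morph (rmul y)) => [a b|]; rewrite ?rmulDr ?rmul0r. Qed.

End RngFacts.

(** * Additive spans and decompositions along a family *)

Section AdditiveSpan.
Variable V : zmodType.

Definition add_closed (K : set V) := K 0 /\ forall x y, K x -> K y -> K (x + y).

Inductive add_span (G : set V) : set V :=
| add_span0 : add_span G 0
| add_spanD x y : G x -> add_span G y -> add_span G (x + y).

Lemma add_span_closed G : add_closed (add_span G).
Proof.
split=> [|x y]; first exact: add_span0.
elim=> [|a b Ga _ IHb] Sy; first by rewrite add0r.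
by rewrite -addrA; apply: add_spanD => //; apply: IHb.
Qed.

Lemma sub_add_span G : G `<=` add_span G.
Proof.
by move=> x Gx; rewrite -[x]addr0; apply: add_spanD => //; apply: add_span0.
Qed.

End AdditiveSpan.

Lemma add_span_morph (U V : zmodType) (f : U -> V) (G : set U) (K : set V) :
    {morph f : x y / x + y} -> add_closed K -> (forall x, G x -> K (f x)) ->
  forall x, add_span G x -> K (f x).
Proof.
move=> fD [K0 KD] GK x; elim=> [|a b /GK Ka _ Kb]; first by rewrite (morphD0 fD).
by rewrite fD; apply: KD.
Qed.

Lemma add_span_subset (V : zmodType) (G K : set V) :
  add_closed K -> G `<=` K -> add_span G `<=` K.
Proof. by move=> cK GK; apply: (@add_span_morph _ _ id). Qed.

Lemma subgroup_add_closed (V : zmodType) (K : set V) :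
  subgroup K -> add_closed K.
Proof.
move=> [K0 KB]; split=> // x y Kx Ky.
by rewrite -[y]opprK; apply: (KB) => //; rewrite -[- y]add0r; apply: KB.
Qed.

(** [add_span] only forms sums, so opposites must already be available among the generators. *)
Lemma add_span_subgroup (V : zmodType) (G : set V) :
  (forall x, G x -> G (- x)) -> subgroup (add_span G).
Proof.
move=> GN; have cG := add_span_closed G; split=> [|x y Sx Sy]; first by case: cG.
case: (cG) => _; apply=> //.
apply: (add_span_morph (@opprD V) cG) Sy => z /GN; exact: sub_add_span.
Qed.

(** Terms with the same index are merged. The distinct indices are what allow directness of a
    grading to be applied to the resulting sum. *)
Lemma add_span_family (V : zmodType) (I : eqType) (W : I -> set V) :
    (forall n, add_closed (W n)) ->
  forall x, add_span (\bigcup_n W n) x ->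
  exists (s : seq I) (c : I -> V),
    [/\ uniq s, forall n, W n (c n) & x = \sum_(n <- s) c n].
Proof.
move=> cW x; elim=> [|a b [n _ Wa] _ [s [c [us Wc ->]]]].
  exists [::], (fun=> 0); split=> //; last by rewrite big_nil.
  by move=> n; case: (cW n).
have [sn|sn] := boolP (n \in s).
  exists s, (fun m => (if m == n then a else 0) + c m); split=> // [m|].
    by case: (cW m) => W0 WD; apply: WD => //; case: eqP => [->|].
  rewrite big_split; congr (_ + _).
  by rewrite (bigD1_seq n sn us) /= eqxx big1 ?addr0 // => m /negbTE ->.
exists (n :: s), (fun m => if m == n then a else c m); split=> [|m|].
- by rewrite /= sn.
- by case: eqP => [->|].
rewrite big_cons eqxx; congr (_ + _); apply: eq_big_seq => m sm.
by case: eqP sm sn => // -> ->.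
Qed.

(** * Local units from condition (FS) *)

Section Uniqueness.
Variables (R : rngType) (P Q : bimodType R) (psi : tensor P Q -> R).
Hypothesis hFS : conditionFS psi.
Variables (B : rngType) (S : P -> B) (T : Q -> B) (sigma : R -> B).
Hypothesis hrep : covariant_rep psi S T sigma.
Implicit Types (p : P) (q : Q) (r : R) (x y : B) (l : seq (Q * P)).

Let SD : {morph S : a b / a + b}. Proof. exact: covS_add hrep. Qed.
Let TD : {morph T : a b / a + b}. Proof. exact: covT_add hrep. Qed.
Let sD : {morph sigma : a b / a + b}. Proof. by case: (cov_sigma hrep). Qed.
Let sM : {morph sigma : a b / a ** b}. Proof. by case: (cov_sigma hrep). Qed.
Let ST p q : S p ** T q = sigma (psi (p \ox q)).
Proof. by rewrite (cov_psi hrep). Qed.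

(* The image of \sum theta_(q, p) under pi. *)
Definition TSsum l : B := \sum_(c <- l) T c.1 ** S c.2.

Lemma TSsum_T l q : TSsum l ** T q = T (\sum_(c <- l) thetaQ psi c.1 c.2 q).
Proof.
rewrite rmul_suml (big_morph _ TD (morphD0 TD)); apply: eq_bigr => c _.
by rewrite -rmulA ST (covT_ract hrep).
Qed.

Lemma S_TSsum l p :
  S p ** TSsum l = S (\sum_(c <- l) thetaP psi c.2 c.1 p).
Proof.
rewrite rmul_sumr (big_morph _ SD (morphD0 SD)); apply: eq_bigr => c _.
by rewrite rmulA ST (covS_lact hrep).
Qed.

Lemma left_local_unit (qs : seq Q) :
  exists l, {in qs, forall q, \sum_(c <- l) thetaQ psi c.1 c.2 q = q}.
Proof.
have [Theta [_ [[l Hl] _ H _]]] := hFS qs [::].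
by exists l => q /H; rewrite Hl.
Qed.

Lemma right_local_unit (ps : seq P) :
  exists l, {in ps, forall p, \sum_(c <- l) thetaP psi c.2 c.1 p = p}.
Proof.
have [_ [Omega [_ [l Hl] _ H]]] := hFS [::] ps.
(* [FQP] lists its pairs as (p, q), whereas [TSsum] expects (q, p). *)
exists [seq (c.2, c.1) | c <- l] => p /H; rewrite Hl => E.
by rewrite big_map /= -[RHS]E.
Qed.

(* By (FS), [x] is then fixed under left multiplication by some [TSsum l]. *)
Definition left_supported : set B := [set x | exists qs : seq Q,
  forall e, {in qs, forall q, e ** T q = T q} -> e ** x = x].
Definition right_supported : set B := [set x | exists ps : seq P,
  forall e, {in ps, forall p, S p ** e = S p} -> x ** e = x].

Lemma left_supported_closed : add_closed left_supported.
Proof.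
split=> [|x y [s Hs] [t Ht]]; first by exists [::] => e _; rewrite rmul0r.
exists (s ++ t) => e He; rewrite rmulDr Hs ?Ht // => q Hq;
  by apply: He; rewrite mem_cat Hq ?orbT.
Qed.

Lemma right_supported_closed : add_closed right_supported.
Proof.
split=> [|x y [s Hs] [t Ht]]; first by exists [::] => e _; rewrite rmul0l.
exists (s ++ t) => e He; rewrite rmulDl Hs ?Ht // => q Hq;
  by apply: He; rewrite mem_cat Hq ?orbT.
Qed.

Lemma left_supported_T q : left_supported (T q).
Proof. by exists [:: q] => e; apply; rewrite inE. Qed.

Lemma left_supported_Tmul q x : left_supported (T q ** x).
Proof. by exists [:: q] => e He; rewrite rmulA He ?inE. Qed.

Lemma right_supported_mulS x p : right_supported (x ** S p).
Proof. by exists [:: p] => e He; rewrite -rmulA He ?inE. Qed.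

Lemma left_supportedP x : left_supported x -> exists l, TSsum l ** x = x.
Proof.
move=> [qs Hx]; have [l Hl] := left_local_unit qs; exists l.
by apply: Hx => q qqs; rewrite TSsum_T Hl.
Qed.

Lemma right_supportedP x : right_supported x -> exists l, x ** TSsum l = x.
Proof.
move=> [ps Hx]; have [l Hl] := right_local_unit ps; exists l.
by apply: Hx => p pps; rewrite S_TSsum Hl.
Qed.

Lemma left_supported_eq0 x :
  left_supported x -> (forall p, S p ** x = 0) -> x = 0.
Proof.
move=> /left_supportedP [l lx] Sx0; rewrite -lx rmul_suml big1 // => c _.
by rewrite -rmulA Sx0 rmul0r.
Qed.

Lemma right_supported_eq0 x :
  right_supported x -> (forall q, x ** T q = 0) -> x = 0.
Proof.
move=> /right_supportedP [l lx] xT0; rewrite -lx rmul_sumr big1 // => c _.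
by rewrite rmulA xT0 rmul0l.
Qed.

(** * Homogeneous words in [T], [sigma] and [S] *)

Lemma T_expand q : exists l, T q = \sum_(c <- l) T c.1 ** sigma (psi (c.2 \ox q)).
Proof.
have [l Hl] := left_local_unit [:: q]; exists l.
rewrite -[in LHS](Hl q) ?inE // (big_morph _ TD (morphD0 TD)).
by apply: eq_bigr => c _; rewrite (covT_ract hrep).
Qed.

Lemma S_expand p : exists l, S p = \sum_(c <- l) sigma (psi (p \ox c.1)) ** S c.2.
Proof.
have [l Hl] := right_local_unit [:: p]; exists l.
rewrite -[in LHS](Hl p) ?inE // (big_morph _ SD (morphD0 SD)).
by apply: eq_bigr => c _; rewrite (covS_lact hrep).
Qed.

(* [core m] is sigma(R) + TQ SP + ... + (TQ)^m (SP)^m. *)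
Fixpoint core (m : nat) : set B :=
  if m is m'.+1 then
    [set x | exists r y, x = sigma r + y /\
      add_span [set z | exists q c p, core m' c /\ z = T q ** c ** S p] y]
  else range sigma.

Fixpoint posdeg (n : nat) : set B :=
  if n is n'.+1 then add_span [set z | exists q v, posdeg n' v /\ z = T q ** v]
  else \bigcup_m core m.

Fixpoint negdeg (n : nat) : set B :=
  if n is n'.+1 then add_span [set z | exists v p, negdeg n' v /\ z = v ** S p]
  else \bigcup_m core m.

Definition homog (n : int) : set B :=
  match n with Posz k => posdeg k | Negz k => negdeg k.+1 end.

Lemma core_subgroup m : subgroup (core m).
Proof.
elim: m => [|m IHm] /=.
  split=> [|_ _ [r _ <-] [s _ <-]]; first by exists 0; rewrite ?(morphD0 sD).
  by exists (r - s); rewrite ?(morphDB sD).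
have: subgroup (add_span [set z | exists q c p, core m c /\ z = T q ** c ** S p]).
  apply: add_span_subgroup => _ [q [c [p [Cc ->]]]]; exists (- q), c, p.
  by rewrite (morphDN TD) !rmulNl.
move=> [G0 GB]; split=> [|_ _ [r [y [-> Gy]]] [s [z [-> Gz]]]].
  by exists 0, 0; rewrite (morphD0 sD) addr0.
exists (r - s), (y - z); split; last exact: GB.
by rewrite (morphDB sD) opprD addrACA.
Qed.

Lemma core_S m : core m `<=` core m.+1.
Proof.
elim: m => [|m IHm] x.
  by move=> [r _ <-]; exists r, 0; split; [rewrite addr0 | apply: add_span0].
move=> [r [y [-> Gy]]]; exists r, y; split=> //.
apply: (add_span_subset (add_span_closed _)) Gy => z [q [c [p [Cc ->]]]].
by apply: sub_add_span; exists q, c, p; split=> //; apply: IHm.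
Qed.

Lemma core_le m n : (m <= n)%N -> core m `<=` core n.
Proof.
elim: n => [|n IHn]; first by rewrite leqn0 => /eqP->.
rewrite leq_eqVlt => /predU1P [-> //|/IHn H x /H]; exact: core_S.
Qed.

Lemma core_union_subgroup : subgroup (\bigcup_m core m).
Proof.
split=> [|x y [m _ Cx] [n _ Cy]].
  by exists 0%N => //; case: (core_subgroup 0).
exists (maxn m n) => //; case: (core_subgroup (maxn m n)) => _; apply.
  exact: core_le (leq_maxl _ _) _ Cx.
exact: core_le (leq_maxr _ _) _ Cy.
Qed.

Lemma posdeg_subgroup n : subgroup (posdeg n).
Proof.
case: n => [|n]; first exact: core_union_subgroup.
apply: add_span_subgroup => _ [q [v [Vv ->]]]; exists (- q), v.
by rewrite (morphDN TD) rmulNl.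
Qed.

Lemma negdeg_subgroup n : subgroup (negdeg n).
Proof.
case: n => [|n]; first exact: core_union_subgroup.
apply: add_span_subgroup => _ [v [p [Vv ->]]]; exists v, (- p).
by rewrite (morphDN SD) rmulNr.
Qed.

Lemma homog_subgroup n : subgroup (homog n).
Proof. by case: n => n; [apply: posdeg_subgroup | apply: negdeg_subgroup]. Qed.

Lemma core_mull m r x : core m x -> core m (sigma r ** x).
Proof.
elim: m x => [|m IHm] x; first by move=> [s _ <-]; exists (r ** s).
move=> [s [y [-> Gy]]]; exists (r ** s), (sigma r ** y).
rewrite rmulDr sM; split=> //.
apply: (add_span_morph (rmulDr _) (add_span_closed _)) Gy => _ [q [c [p [Cc ->]]]].
apply: sub_add_span; exists (r *> q), c, p; split=> //.
by rewrite (covT_lact hrep) !rmulA.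
Qed.

Lemma core_mulr m r x : core m x -> core m (x ** sigma r).
Proof.
elim: m x => [|m IHm] x; first by move=> [s _ <-]; exists (s ** r).
move=> [s [y [-> Gy]]]; exists (s ** r), (y ** sigma r).
rewrite rmulDl sM; split=> //.
have mD : {morph rmul^~ (sigma r) : a b / a + b} by move=> a b; rewrite rmulDl.
apply: (add_span_morph mD (add_span_closed _)) Gy => _ [q [c [p [Cc ->]]]].
apply: sub_add_span; exists q, c, (p <* r); split=> //.
by rewrite (covS_ract hrep) !rmulA.
Qed.

(** The outer letters cancel: S(p) T(q') and S(p') T(q) both lie in sigma(R), which [core m] absorbs
    on either side. This drop in [m] drives the induction in [core_ker]. *)
Lemma core_sandwich m p q x : core m.+1 x -> core m (S p ** x ** T q).
Proof.
have cC := subgroup_add_closed (core_subgroup m).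
move=> [r [y [-> Gy]]]; rewrite rmulDr rmulDl; case: (cC) => _; apply.
  apply: (core_le (leq0n m)); rewrite -(covS_ract hrep) ST.
  by eexists.
have mD : {morph (fun z => S p ** z ** T q) : a b / a + b}.
  by move=> a b; rewrite rmulDr rmulDl.
apply: (add_span_morph mD cC) Gy => _ [q' [c [p' [Cc ->]]]].
rewrite !rmulA ST -[X in core m X]rmulA ST.
by apply: core_mulr; apply: core_mull.
Qed.

Lemma posdeg_mull n r x : posdeg n x -> posdeg n (sigma r ** x).
Proof.
case: n => [|n]; first by move=> [m _ Cx]; exists m => //; apply: core_mull.
apply: (add_span_morph (rmulDr _) (add_span_closed _)) => _ [q [v [Vv ->]]].
apply: sub_add_span; exists (r *> q), v; split=> //.
by rewrite (covT_lact hrep) rmulA.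
Qed.

(** Unlike in [posdeg_mull], no letter T stands on the left to absorb [sigma r], so the induction
    carries it down to the core. *)
Lemma negdeg_mull n r x : negdeg n x -> negdeg n (sigma r ** x).
Proof.
elim: n x => [|n IHn] x; first by move=> [m _ Cx]; exists m => //; apply: core_mull.
apply: (add_span_morph (rmulDr _) (add_span_closed _)) => _ [v [p [Vv ->]]].
by apply: sub_add_span; exists (sigma r ** v), p; rewrite rmulA; split=> //; apply: IHn.
Qed.

Lemma negdeg_mulr n r x : negdeg n x -> negdeg n (x ** sigma r).
Proof.
case: n => [|n]; first by move=> [m _ Cx]; exists m => //; apply: core_mulr.
have mD : {morph rmul^~ (sigma r) : a b / a + b} by move=> a b; rewrite rmulDl.
apply: (add_span_morph mD (add_span_closed _)) => _ [v [p [Vv ->]]].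
apply: sub_add_span; exists v, (p <* r); split=> //.
by rewrite (covS_ract hrep) rmulA.
Qed.

(** A word of degree 1 must end in a core element, which a lone T(q) lacks; the local unit in
    [T_expand] supplies factors sigma(psi(p, q)). *)
Lemma T_posdeg1 q : posdeg 1 (T q).
Proof.
have [l ->] := T_expand q.
have [H0 HD] := subgroup_add_closed (posdeg_subgroup 1).
apply: big_ind => // c _; apply: sub_add_span; do 2!eexists; split; last reflexivity.
by exists 0%N => //; eexists.
Qed.

Lemma S_negdeg1 p : negdeg 1 (S p).
Proof.
have [l ->] := S_expand p.
have [H0 HD] := subgroup_add_closed (negdeg_subgroup 1).
apply: big_ind => // c _; apply: sub_add_span; do 2!eexists; split; last reflexivity.
by exists 0%N => //; eexists.
Qed.

(** The new letter T moves to the innermost core element, where together with the first S it turns a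
    member of [core m] into one of [core m.+1]. *)
Lemma negdeg_mulT n q x : negdeg n.+1 x -> negdeg n (T q ** x).
Proof.
elim: n x => [|n IHn] x.
  apply: (add_span_morph (rmulDr _)).
    exact: subgroup_add_closed (negdeg_subgroup 0).
  move=> _ [v [p [[m _ Cv] ->]]]; exists m.+1 => //.
  (* The [sigma] part of this core element is 0. *)
  exists 0, (T q ** (v ** S p)); rewrite (morphD0 sD) add0r; split=> //.
  by apply: sub_add_span; exists q, v, p; rewrite rmulA.
apply: (add_span_morph (rmulDr _) (add_span_closed _)) => _ [v [p [Vv ->]]].
apply: sub_add_span; exists (T q ** v), p; rewrite rmulA; split=> //.
exact: IHn.
Qed.

Lemma negdeg_mulrT n q x : negdeg n.+1 x -> negdeg n (x ** T q).
Proof.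
have mD : {morph rmul^~ (T q) : a b / a + b} by move=> a b; rewrite rmulDl.
apply: (add_span_morph mD).
  exact: subgroup_add_closed (negdeg_subgroup n).
by move=> _ [v [p [Vv ->]]]; rewrite -rmulA ST; apply: negdeg_mulr.
Qed.

Lemma posdeg_mulS n p x : posdeg n.+1 x -> posdeg n (S p ** x).
Proof.
apply: (add_span_morph (rmulDr _)).
  exact: subgroup_add_closed (posdeg_subgroup n).
by move=> _ [q [v [Vv ->]]]; rewrite rmulA ST; apply: posdeg_mull.
Qed.

(** On sigma(R) the product is again some S(p'). On a longer word S(p) cancels the leading T,
    leaving a core element followed by one S. *)
Lemma core_mulS m p x : core m x -> negdeg 1 (S p ** x).
Proof.
case: m => [|m]; first by move=> [r _ <-]; rewrite -(covS_ract hrep); apply: S_negdeg1.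
have cN := subgroup_add_closed (negdeg_subgroup 1).
move=> [r [y [-> Gy]]]; rewrite rmulDr -(covS_ract hrep).
case: (cN) => _; apply; first exact: S_negdeg1.
apply: (add_span_morph (rmulDr _) cN) Gy => _ [q [c [p' [Cc ->]]]].
rewrite !rmulA ST; apply: sub_add_span; do 2!eexists; split; last reflexivity.
by exists m => //; apply: core_mull.
Qed.

Lemma negdeg_mulS n p x : negdeg n x -> negdeg n.+1 (S p ** x).
Proof.
elim: n x => [|n IHn] x; first by move=> [m _]; apply: core_mulS.
apply: (add_span_morph (rmulDr _) (add_span_closed _)) => _ [v [p' [Vv ->]]].
apply: sub_add_span; exists (S p ** v), p'; rewrite rmulA; split=> //.
exact: IHn.
Qed.

(** * The homogeneous words span the ring *)

Lemma homog_mulR n r x : homog n x -> homog n (sigma r ** x).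
Proof. by case: n => n; [apply: posdeg_mull | apply: negdeg_mull]. Qed.

Lemma homog_mulT n q x : homog n x -> exists m, homog m (T q ** x).
Proof.
case: n => n Hx; first by exists n.+1; apply: sub_add_span; exists q, x.
have := negdeg_mulT q Hx; case: n {Hx} => [|n] Hx; first by exists 0.
by exists (Negz n).
Qed.

Lemma homog_mulS n p x : homog n x -> exists m, homog m (S p ** x).
Proof.
case: n => [[|n]|n] Hx.
- by exists (Negz 0); apply: negdeg_mulS.
- by exists n; apply: posdeg_mulS.
- by exists (Negz n.+1); apply: negdeg_mulS.
Qed.

Lemma homog_span : surjective_rep S T sigma ->
  forall x, add_span (\bigcup_n homog n) x.
Proof.
move=> hgen; set X := add_span _.
have cX : add_closed X := add_span_closed _.
have homogX n x : homog n x -> X x by move=> Hx; apply: sub_add_span; exists n.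
have [X0 XB] : subgroup X.
  apply: add_span_subgroup => x [n _ Hx]; exists n => //.
  by case: (homog_subgroup n) => H0 HB; rewrite -[- x]add0r; apply: HB.
have mulX y : (forall n x, homog n x -> exists m, homog m (y ** x)) ->
    forall x, X x -> X (y ** x).
  move=> H; apply: (add_span_morph (rmulDr y) cX) => x [n _ /H [m Hm]].
  exact: homogX Hm.
move=> x; suff [] : X x /\ forall y, X y -> X (x ** y) by [].
have : smallest (@subrng B) (range sigma `|` range T `|` range S) x.
  by rewrite [smallest _ _]hgen.
(* The elements of [X] that map [X] into itself by left multiplication form a subring, so only the
   generators have to be checked. This avoids multiplying two arbitrary words. *)
move=> /(_ [set z | X z /\ forall y, X y -> X (z ** y)]); apply; split.
  split; first split=> [|y z [Xy Hy] [Xz Hz]].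
  - by split=> // y _; rewrite rmul0l.
  - by split=> [|w Xw]; rewrite ?rmulBl; apply: XB => //; [apply: Hy | apply: Hz].
  - move=> y z [Xy Hy] [Xz Hz]; split=> [|w Xw]; first exact: Hy.
    by rewrite -rmulA; apply/Hy/Hz.
move=> _ [[|]|] [a _ <-].
- split; first by apply: (homogX 0); exists 0%N => //; exists a.
  by apply: mulX => n z Hz; exists n; apply: homog_mulR.
- split; first exact: (homogX 1 _ (T_posdeg1 a)).
  by apply: mulX => n z; apply: homog_mulT.
- split; first exact: (homogX (Negz 0) _ (S_negdeg1 a)).
  by apply: mulX => n z; apply: homog_mulS.
Qed.

(** * The map [pi] and the coincidence ideal *)

Variable pi : (Q -> Q) -> B.
Hypothesis hpi : is_piT psi S T pi.

(** In particular [TSsum l] depends only on the operator that [l] represents. *)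
Lemma pi_sum l (f : Q -> Q) :
  (forall q, f q = \sum_(c <- l) thetaQ psi c.1 c.2 q) -> pi f = TSsum l.
Proof.
elim: l f => [|c l IHl] f Hf.
  (* The empty sum is written as a theta because [pi] is only specified through [piT_theta] and
     sums. *)
  have -> : f = thetaQ psi 0 0.
    apply: funext => x; rewrite Hf big_nil.
    by rewrite /thetaQ (@morphD0 _ _ (ract^~ _)) // => a b; rewrite ractDl.
  by rewrite (piT_theta hpi) (morphD0 TD) rmul0l /TSsum big_nil.
have -> : f = thetaQ psi c.1 c.2 \+ (fun q => \sum_(c <- l) thetaQ psi c.1 c.2 q).
  by apply: funext => x; rewrite Hf big_cons.
rewrite (piT_add hpi) ?(piT_theta hpi) ?(IHl (fun q => \sum_(c <- l) _ q)) //.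
- by rewrite /TSsum big_cons.
- by exists [:: c] => x; rewrite big_seq1.
- by exists l.
Qed.

Variables (A : rngType) (eta : B -> A).
Hypothesis heta : rng_hom eta.
Hypothesis eta_sigma : forall r, r <> 0 -> eta (sigma r) <> 0.

Let eD : {morph eta : a b / a + b}. Proof. by case: heta. Qed.
Let eM : {morph eta : a b / a ** b}. Proof. by case: heta. Qed.
Let es0 r : eta (sigma r) = 0 -> r = 0.
Proof. by move=> e0; apply: contrapT => /eta_sigma. Qed.

(** A local unit writes d = q - q' as a sum of terms c.1 psi(c.2, d). If T(d) = 0, then
    sigma(psi(c.2, d)) = S(c.2) T(d) = 0, and [sigma] is injective because [eta] kills no nonzero
    [sigma r]. *)
Lemma T_injective : injective T.
Proof.
move=> q q' eqT; apply/subr0_eq; have [l Hl] := left_local_unit [:: q - q'].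
rewrite -(Hl (q - q')) ?inE // big1 // => c _; rewrite /thetaQ.
have -> : psi (c.2 \ox (q - q')) = 0.
  by apply: es0; rewrite -ST (morphDB TD) eqT subrr rmul0r (morphD0 eD).
exact: morphD0 (ractDr _).
Qed.

Let theta_act r l := forall q, r *> q = \sum_(c <- l) thetaQ psi c.1 c.2 q.

(* The [r] in Delta^-1(F_P(Q)) whose image under [eta \o sigma] agrees with that
   under [eta \o pi \o Delta]. *)
Definition coincidence_set : set R :=
  [set r | exists l, theta_act r l /\ eta (sigma r) = eta (TSsum l)].

Lemma coincidence_ideal : two_sided_ideal coincidence_set.
Proof.
split; first split.
- exists [::]; split=> [x|]; last by rewrite (morphD0 sD) /TSsum big_nil.
  by rewrite big_nil (@morphD0 _ _ (lact^~ x)) // => a b; rewrite lactDl.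
- move=> r s [l [Hl el]] [l' [Hl' el']].
  exists (l ++ [seq (- c.1, c.2) | c <- l']); split=> [x|].
    rewrite (@morphDB _ _ (lact^~ x)); last by move=> a b; rewrite lactDl.
    rewrite Hl Hl' big_cat big_map -sumrN; congr (_ + _); apply: eq_bigr => c _.
    by rewrite /thetaQ (morphDN (ractDl _)).
  rewrite (morphDB sD) (morphDB eD) el el' -(morphDB eD) /TSsum big_cat big_map.
  rewrite -sumrN; congr (eta (_ + _)); apply: eq_bigr => c _.
  by rewrite /= (morphDN TD) rmulNl.
move=> r s [l [Hl el]]; split.
  (* Composing Delta(s) after theta_(q,p) gives theta_(sq,p). *)
  exists [seq (s *> c.1, c.2) | c <- l]; split=> [x|].
    rewrite lactA Hl (big_morph _ (lactDr s) (morphD0 (lactDr s))) big_map.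
    by apply: eq_bigr => c _; rewrite /thetaQ lractA.
  rewrite sM eM el -eM /TSsum rmul_sumr big_map; congr eta.
  by apply: eq_bigr => c _; rewrite (covT_lact hrep) rmulA.
(* Composing theta_(q,p) after Delta(s) gives theta_(q,ps), by balancedness of the tensor
   product. *)
exists [seq (c.1, c.2 <* s) | c <- l]; split=> [x|].
  rewrite lactA Hl big_map.
  by apply: eq_bigr => c _; rewrite /thetaQ pure_tensor_bal.
rewrite sM eM el -eM /TSsum rmul_suml big_map; congr eta.
by apply: eq_bigr => c _; rewrite (covS_ract hrep) rmulA.
Qed.

Lemma coincidence_compatible : compatible psi (Ideal coincidence_ideal).
Proof. by move=> r [l [Hl _]]; exists l. Qed.

Lemma coincidence_faithful : @faithful _ Q (Ideal coincidence_ideal).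
Proof.
apply/seteqP; split=> [r [[l [Hl el]] r0]|_ ->].
  apply: es0; rewrite el -(pi_sum Hl).
  (* As Delta r = 0, the empty list represents it as well as [l], so [TSsum l] = 0 and
     [eta (sigma r)] = 0. *)
  rewrite (@pi_sum [::]) ?/TSsum ?big_nil ?(morphD0 eD) // => q.
  by rewrite big_nil; apply: r0.
split; first by case: coincidence_ideal => -[].
by move=> q; rewrite /Delta (@morphD0 _ _ (lact^~ q)) // => a b; rewrite lactDl.
Qed.

(** * Injectivity of [eta] on each homogeneous set *)

Variable J : ideal R.
Hypothesis hJ : forall J' : ideal R,
  compatible psi J' -> @faithful _ Q J' -> J' `<=` J.
Hypothesis hJpi : forall r, ideal_set J r -> sigma r = pi (Delta r).

Lemma core_ker m x : core m x -> eta x = 0 -> x = 0.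
Proof.
elim: m x => [|m IHm] x; first by move=> [r _ <-] /es0 ->; rewrite (morphD0 sD).
move=> Cx ex0.
have SxT p q : S p ** x ** T q = 0.
  by apply: IHm; rewrite ?eM ?ex0 ?rmul0r ?rmul0l //; apply: core_sandwich.
move: Cx => [r [y [xE Gy]]].
(* The product is left supported: sigma(r) T(q) = T(rq), and every word in [y] begins with a T. *)
have xT q : x ** T q = 0.
  apply: left_supported_eq0 => [|p]; last by rewrite rmulA.
  rewrite xE rmulDl -(covT_lact hrep); case: left_supported_closed => _; apply.
    exact: left_supported_T.
  have mD : {morph rmul^~ (T q) : a b / a + b} by move=> a b; rewrite rmulDl.
  apply: (add_span_morph mD left_supported_closed) Gy => _ [q' [c [p [_ ->]]]].
  by rewrite -!rmulA; apply: left_supported_Tmul.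
(* Only [y] is sure to have a right local unit, since its words end in S; the summand [sigma r] of
   [x] may have none. *)
have [l yl] : exists l, y ** TSsum l = y.
  apply: right_supportedP; apply: (add_span_subset right_supported_closed) Gy.
  by move=> _ [q' [c [p [_ ->]]]]; apply: right_supported_mulS.
(* With e = [TSsum l], x e = 0 because x T(q) = 0. Expanding gives sigma(r) e + y = 0, and sigma(r)
   e is the [TSsum] of the list with [r] acting on its left entries. *)
have yE : TSsum [seq (r *> c.1, c.2) | c <- l] = - y.
  apply/eqP; rewrite -addr_eq0 /TSsum big_map; apply/eqP.
  transitivity (x ** TSsum l); last first.
    by rewrite rmul_sumr big1 // => c _; rewrite rmulA xT rmul0l.
  rewrite xE rmulDl yl rmul_sumr; congr (_ + _); apply: eq_bigr => c _.
  by rewrite (covT_lact hrep) rmulA.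
(* Here x T(q) = 0 reads T(rq) = -y T(q), and [T_injective] turns this into the formula for rq. *)
have rl : theta_act r [seq (r *> c.1, c.2) | c <- l].
  move=> q; apply: T_injective; rewrite -TSsum_T yE (covT_lact hrep).
  by apply/subr0_eq; rewrite -rmulBl opprK -xE.
have Jr : ideal_set J r.
  apply: (hJ coincidence_compatible coincidence_faithful).
  (* The assumption [eta x = 0] is exactly the required agreement, as x = sigma(r) - [TSsum] of this
     list. *)
  exists [seq (r *> c.1, c.2) | c <- l]; split=> //; apply/subr0_eq.
  by rewrite -(morphDB eD) yE opprK -xE.
by rewrite xE (hJpi Jr) (pi_sum rl) yE addNr.
Qed.

(** Left multiplication by S(p) lowers the degree and stays in the kernel, so induction applies to
    each S(p) x. *)
Lemma posdeg_ker n x : posdeg n x -> eta x = 0 -> x = 0.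
Proof.
elim: n x => [|n IHn] x; first by move=> [m _]; apply: core_ker.
move=> Vx ex0; apply: left_supported_eq0 => [|p].
  apply: (add_span_subset left_supported_closed) Vx => _ [q [v [_ ->]]].
  exact: left_supported_Tmul.
by apply: IHn; [apply: posdeg_mulS | rewrite eM ex0 rmul0r].
Qed.

Lemma negdeg_ker n x : negdeg n x -> eta x = 0 -> x = 0.
Proof.
elim: n x => [|n IHn] x; first by move=> [m _]; apply: core_ker.
move=> Vx ex0; apply: right_supported_eq0 => [|q].
  apply: (add_span_subset right_supported_closed) Vx => _ [v [p [_ ->]]].
  exact: right_supported_mulS.
by apply: IHn; [apply: negdeg_mulrT | rewrite eM ex0 rmul0l].
Qed.

(** * Separating degrees with the grading of [A] *)

Variable Ag : int -> set A.
Hypothesis hAg : Z_grading Ag.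
Hypothesis etaR : forall r, Ag 0 (eta (sigma r)).
Hypothesis etaQ : forall q, Ag 1 (eta (T q)).
Hypothesis etaP : forall p, Ag (- 1) (eta (S p)).

Lemma core_graded m x : core m x -> Ag 0 (eta x).
Proof.
have [A0 AD] := subgroup_add_closed (grading_subgroup hAg 0).
elim: m x => [|m IHm] x; first by move=> [r _ <-].
move=> [r [y [-> Gy]]]; rewrite eD; apply: (AD) => //.
apply: (add_span_morph eD) Gy => // _ [q [c [p [Cc ->]]]]; rewrite !eM.
have := grading_mul hAg (grading_mul hAg (etaQ q) (IHm _ Cc)) (etaP p).
by rewrite addr0 subrr.
Qed.

Lemma posdeg_graded n x : posdeg n x -> Ag n (eta x).
Proof.
elim: n x => [|n IHn] x; first by move=> [m _]; apply: core_graded.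
apply: (add_span_morph eD) => [|_ [q [v [Vv ->]]]].
  exact: subgroup_add_closed (grading_subgroup hAg _).
by rewrite eM intS; apply: (grading_mul hAg); last exact: IHn.
Qed.

Lemma negdeg_graded n x : negdeg n x -> Ag (- n%:Z) (eta x).
Proof.
elim: n x => [|n IHn] x; first by move=> [m _]; rewrite oppr0; apply: core_graded.
apply: (add_span_morph eD) => [|_ [v [p [Vv ->]]]].
  exact: subgroup_add_closed (grading_subgroup hAg _).
by rewrite eM intS opprD addrC; apply: (grading_mul hAg); first exact: IHn.
Qed.

Lemma homog_graded n x : homog n x -> Ag n (eta x).
Proof.
by case: n => n; [apply: posdeg_graded | rewrite NegzE; apply: negdeg_graded].
Qed.

Lemma homog_ker n x : homog n x -> eta x = 0 -> x = 0.
Proof. by case: n => n; [apply: posdeg_ker | apply: negdeg_ker]. Qed.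

Theorem graded_uniqueness : surjective_rep S T sigma -> injective eta.
Proof.
move=> hgen x y exy; apply/subr0_eq.
have: eta (x - y) = 0 by rewrite (morphDB eD) exy subrr.
have := homog_span hgen (x - y).
move=> /(add_span_family (fun n => subgroup_add_closed (homog_subgroup n))).
move=> [s [c [us Hc ->]]]; rewrite (big_morph _ eD (morphD0 eD)) => e0.
(* The images [eta (c n)] lie in distinct degrees and sum to 0, so each vanishes, and [homog_ker]
   applies to each [c n]. *)
apply: big1_seq => n /= sn; apply: (homog_ker (Hc n)).
apply: (grading_direct hAg us _ e0 sn) => m; exact: homog_graded.
Qed.

End Uniqueness.

(** * Transport along a ring homomorphism and conclusion *)

Lemma covariant_rep_comp (R : rngType) (P Q : bimodType R) (psi : tensor P Q -> R)
    (B C : rngType) (f : B -> C) (S : P -> B) (T : Q -> B) (sigma : R -> B) :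
  rng_hom f -> covariant_rep psi S T sigma ->
  covariant_rep psi (f \o S) (f \o T) (f \o sigma).
Proof.
move=> [fD fM] [SD TD [sD sM] Sr Sl Tr Tl ST]; split=> [a b|a b||*|*|*|*|*] /=.
- by rewrite SD fD.
- by rewrite TD fD.
- by split=> a b /=; rewrite ?sD ?fD ?sM ?fM.
- by rewrite Sr fM.
- by rewrite Sl fM.
- by rewrite Tr fM.
- by rewrite Tl fM.
- by rewrite -fM -ST.
Qed.

Lemma surjective_rep_comp (R : rngType) (P Q : bimodType R)
    (B C : rngType) (f : B -> C) (S : P -> B) (T : Q -> B) (sigma : R -> B) :
  rng_hom f -> (forall y, exists x, f x = y) -> surjective_rep S T sigma ->
  surjective_rep (f \o S) (f \o T) (f \o sigma).
Proof.
move=> [fD fM] fs hgen; apply/seteqP; split=> // y _ M [[[M0 MB] MM] MG].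
have [x <-] := fs y.
have : smallest (@subrng B) (range sigma `|` range T `|` range S) x.
  by rewrite [smallest _ _]hgen.
(* The preimage of a subring containing the new generators is a subring containing the old ones. *)
move=> /(_ (f @^-1` M)); apply; split; first split; first split.
- by rewrite /preimage /= (morphD0 fD).
- by move=> a b Ma Mb; rewrite /preimage /= (morphDB fD); apply: MB.
- by move=> a b Ma Mb; rewrite /preimage /= fM; apply: MM.
move=> _ [[|]|] [a _ <-]; apply: MG; [left; left|left; right|right]; by exists a.
Qed.

Lemma is_piT_comp (R : rngType) (P Q : bimodType R) (psi : tensor P Q -> R)
    (B C : rngType) (f : B -> C) (S : P -> B) (T : Q -> B) (pi : (Q -> Q) -> B) :
  rng_hom f -> is_piT psi S T pi -> is_piT psi (f \o S) (f \o T) (f \o pi).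
Proof.
move=> [fD fM] [piD piM piT]; split=> [g h Fg Fh|g h Fg Fh|q p] /=.
- by rewrite piD.
- by rewrite piM.
- by rewrite piT fM.
Qed.

Theorem corollary5p4 (R : rngType) (P Q : bimodType R) (psi : tensor P Q -> R)
    (hpsi : R_system psi) (hFS : conditionFS psi)
    (TT : rngType) (iP : P -> TT) (iQ : Q -> TT) (iR : R -> TT)
    (hTT : toeplitz_rep psi iP iQ iR)
    (pi : (Q -> Q) -> TT) (hpi : is_piT psi iP iQ pi)
    (J : ideal R) (hJ : uniquely_maximal psi J)
    (Og : int -> set (OJ iR pi J)) (hOg : OJ_grading iP iQ Og)
    (A : rngType) (Ag : int -> set A) (hAg : Z_grading Ag)
    (eta : OJ iR pi J -> A) (heta : graded_hom Og Ag eta)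
    (hne : forall r : R, r <> 0 -> eta (rhoJ iR pi J (iR r)) <> 0) :
  injective eta.
Proof.
have [hrep hgen _] := hTT; have [_ gR gQ gP] := hOg; have [he hgr] := heta.
have [_ _ hmax] := hJ; have hrho := quot_map_hom (TJ iR pi J).
(* The representation used is the Toeplitz one followed by the quotient map [rhoJ]. *)
apply: (graded_uniqueness hFS (covariant_rep_comp hrho hrep)
  (is_piT_comp hrho hpi) he hne hmax _ hAg).
(* [iR r] and [pi (Delta r)] agree in the quotient because their difference is a generator of
   [TJ]. *)
- move=> r Jr; apply/quot_mapP => I [_ GI]; apply: GI; by exists r.
- by move=> r; apply/hgr/gR.
- by move=> q; apply/hgr/gQ.
- by move=> p; apply/hgr/gP.
- exact: (surjective_rep_comp hrho (@quot_map_surj _ _) hgen).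
Qed.
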